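(* Let $G_n$ be a depth-two claw with $n$ leaves and let $1 \leq r \leq n-1$. Then $G_n$ is $r$-EKR. Moreover, if $4 \leq r < n-1$, then $G_n$ is strictly $r$-EKR.
   Context: A depth-two claw with $n$ leaves, $G_n$, is the tree with a root $c$ adjacent to vertices $b_1,\dots,b_n$, where each $b_i$ is adjacent to exactly one further vertex $a_i$ (a leaf); equivalently a star $K_{1,n}$ with every edge subdivided. An $r$-independent set is an independent set of size $r$. A family of sets is intersecting if every two members meet. A canonically intersecting family is the family of all $r$-independent sets containing a fixed vertex. A graph is $r$-EKR if the maximum size of an intersecting family of $r$-independent sets equals the maximum size of a canonically intersecting family; it is strictly $r$-EKR if moreover every intersecting family of $r$-independent sets of maximum size is canonically intersecting. (In $G_n$ a largest canonically intersecting family is the one for a leaf, of size $\binom{n-1}{r-1}2^{r-1}+\binom{n-1}{r-2}$.) *)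

(* Defs.v *)
From mathcomp Require Import all_boot.
Set Implicit Arguments. Unset Strict Implicit. Unset Printing Implicit Defensive.

Section Generic.
Variables (T : finType) (e : rel T).

Definition independent (A : {set T}) : bool :=
  [forall x in A, forall y in A, ~~ e x y].

Definition indep_sets (r : nat) : {set {set T}} :=
  [set A : {set T} | independent A && (#|A| == r)].

Definition intersecting (F : {set {set T}}) : bool :=
  [forall A in F, forall B in F, A :&: B != set0].

Definition star (r : nat) (v : T) : {set {set T}} :=
  [set A in indep_sets r | v \in A].

Definition max_intersecting (r : nat) : nat :=
  \max_(F : {set {set T}} | (F \subset indep_sets r) && intersecting F) #|F|.

Definition max_star (r : nat) : nat := \max_(v : T) #|star r v|.

Definition EKR (r : nat) : Prop := max_intersecting r = max_star r.

Definition strictly_EKR (r : nat) : Prop :=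
  EKR r /\
  forall F : {set {set T}}, F \subset indep_sets r -> intersecting F ->
    #|F| = max_intersecting r -> exists v : T, F = star r v.
End Generic.

(* vertices: None = root c, Some (inl i) = b_i, Some (inr i) = a_i  (i < n) *)
Definition claw_vertex (n : nat) : finType := option ('I_n + 'I_n)%type.

Definition claw_adj (n : nat) : rel (claw_vertex n) :=
  fun x y =>
    match x, y with
    | None, Some (inl _) => true
    | Some (inl _), None => true
    | Some (inl i), Some (inr j) => i == j
    | Some (inr i), Some (inl j) => i == j
    | _, _ => false
    end.

(* Main.v *)
Require Import Defs.
From mathcomp Require Import all_boot all_fingroup all_algebra zify.
Set Implicit Arguments. Unset Strict Implicit. Unset Printing Implicit Defensive.
Import GRing.Theory.

(** Replacing b_i by a_i wherever the result is new keeps a family intersecting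
and of the same size. In a family stable under all these shifts, two members
share the root or a leaf, so its root-free members have pairwise intersecting
leaf traces, which also meet the leaf traces (of size r - 1) of the members
containing c. A trace of size k extends to C(n-k, n-r) root-free r-sets, and
with p_k traces of size k and q root members the family has size at most
sum_k C(n-k, n-r) p_k + q. The star at a leaf attains this with
p_k = C(n-1, k-1) and q = C(n-1, r-2). If n >= 2r - 1, all p_k with k < r are
bounded by Erdos-Ko-Rado and p_r + q <= C(n, r-1) by Katona's cycle method; if
n <= 2r - 2, sizes k and n - k are paired: p_k + p_(n-k) <= C(n, k) by
complementation, q + p_(n-r+1) <= C(n, r-1) likewise, and the smaller size of a
pair has the larger weight and obeys Erdos-Ko-Rado. Equality forces p_1 = 1 when
r < n - 1, so a maximum shifted family is a leaf star, and undoing a shift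
preserves this. *)

(** * Katona's cycle method *)

(** Transposing an element of [A :\: B] with one of [B :\: A] shrinks the difference, so a product
    of transpositions carries [A] to [B]. *)
Lemma perm_imset_exists (T : finType) (A B : {set T}) :
  #|A| = #|B| -> exists s : {perm T}, s @: A = B.
Proof.
have [m] := ubnP #|A :\: B|; elim: m A => // m IHm A ltm eqAB.
have [AB0 | [x xAB]] := set_0Vmem (A :\: B).
  have sAB : A \subset B by rewrite -setD_eq0 AB0.
  exists 1%g; rewrite (eq_imset _ (@perm1 T)) imset_id.
  by apply/eqP; rewrite eqEcard sAB eqAB /=.
have [BA0 | [y yBA]] := set_0Vmem (B :\: A).
  have sBA : B \subset A by rewrite -setD_eq0 BA0.
  have eBA : B = A by apply/eqP; rewrite eqEcard sBA eqAB /=.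
  by move: xAB; rewrite eBA setDv inE.
move: xAB yBA; rewrite !inE => /andP[xB xA] /andP[yA yB].
have nyx : (y == x) = false by apply: contraNF yA => /eqP->.
have tA : tperm x y @: A = y |: A :\ x.
  apply/setP=> z; rewrite -[z in LHS](tpermK x y) mem_imset; last exact: perm_inj.
  rewrite !inE; case: tpermP => [->|->|/eqP nx /eqP ny].
  - by rewrite (negPf yA) eq_sym nyx eqxx.
  - by rewrite eqxx xA.
  - by rewrite (negPf nx) (negPf ny).
have [||s sB] := IHm (tperm x y @: A).
- suff lt : #|tperm x y @: A :\: B| < #|A :\: B| by lia.
  apply: proper_card; apply/properP; split.
    apply/subsetP=> z; rewrite tA !inE.
    by case: (z =P y) => [-> | _] /=; rewrite ?yB // => /and3P[-> _ ->].
  by exists x; rewrite ?tA !inE ?xB ?xA ?eqxx //= orbF eq_sym nyx.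
- by rewrite card_imset //; apply: perm_inj.
exists (tperm x y * s)%g; rewrite -sB -imset_comp.
by apply: eq_imset => z; rewrite /= permM.
Qed.

Definition uniform (T : finType) (k : nat) (F : {set {set T}}) : Prop :=
  forall A, A \in F -> #|A| = k.

(** The permutations sending [A] to a given k-set form a coset, so all these fibres have the same
    size [c]; taking all k-sets as the family determines [c]. *)
Lemma card_perm_imset_mem (T : finType) (k : nat) (A : {set T})
    (F : {set {set T}}) :
    uniform k F -> #|A| = k ->
  #|[set s : {perm T} | s @: A \in F]| * 'C(#|T|, k) = #|F| * #|T|`!.
Proof.
move=> Fk Ak; pose c := #|[set s : {perm T} | s @: A == A]|.
have comp (s t : {perm T}) : (s * t)%g @: A = t @: (s @: A).
  by rewrite -imset_comp; apply: eq_imset => z; rewrite /= permM.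
have fiber (B : {set T}) : #|B| = k -> #|[set s : {perm T} | s @: A == B]| = c.
  move=> Bk; have [t tAB] := perm_imset_exists (etrans Ak (esym Bk)).
  rewrite /c -[RHS](card_imset _ (mulIg t)); apply: eq_card => s.
  rewrite inE; apply/eqP/imsetP => [sAB | [u]].
    exists (s * t^-1)%g; rewrite ?mulgKV // inE comp sAB -tAB -comp mulgV.
    by rewrite (eq_imset _ (@perm1 T)) imset_id.
  by rewrite inE => /eqP uA ->; rewrite comp uA.
have sum G : uniform k G -> #|[set s : {perm T} | s @: A \in G]| = #|G| * c.
  move=> Gk; rewrite -sum1dep_card (partition_big (fun s : {perm T} => s @: A) (mem G)) //=.
  rewrite -sum_nat_const; apply: eq_bigr => B BG.
  rewrite -(fiber B (Gk _ BG)) -sum1dep_card; apply: eq_bigl => s.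
  by case: eqP => [->|]; rewrite ?andbT ?andbF.
have all : #|T|`! = 'C(#|T|, k) * c.
  rewrite -card_draws -sum; last by move=> B; rewrite inE => /eqP.
  rewrite -cardsT -card_perm; apply: eq_card => s; rewrite !inE.
  rewrite card_imset ?Ak ?eqxx; last exact: perm_inj.
  by apply/subsetP=> z _; rewrite inE.
by rewrite sum // all; lia.
Qed.

(** Subtraction is modulo N + 1, so arcs are the cyclic intervals of Katona's argument. *)
Definition arc (N k : nat) (i : 'I_N.+1) : {set 'I_N.+1} :=
  [set x : 'I_N.+1 | (x - i)%R < k].

Lemma card_arc (N k : nat) (i : 'I_N.+1) : k <= N.+1 -> #|arc k i| = k.
Proof.
move=> kN; have -> : arc k i = [set (widen_ord kN x + i)%R | x : 'I_k].
  apply/setP=> y; apply/idP/imsetP => [|[x _ ->]]; rewrite inE; last by rewrite addrK /=.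
  move=> lt; exists (Ordinal lt) => //; apply: (canRL (subrK i)).
  exact: val_inj.
rewrite card_imset ?card_ord // => x y /addIr/(congr1 val) /= xy.
exact: val_inj.
Qed.

Lemma val_addr (N : nat) (x y : 'I_N.+1) : x + y < N.+1 -> (x + y)%R = x + y :> nat.
Proof. by move=> xy; rewrite /= modn_small. Qed.

Definition spread (N : nat) (X : {set 'I_N.+1}) (t : nat) : {set 'I_N.+1} :=
  [set y : 'I_N.+1 | [exists x in X, (y - x)%R <= t]].

(** Each unit of [t] adds a new point unless the spread is already closed under adding 1, and then
    it is the whole cycle. *)
Lemma card_spread (N : nat) (X : {set 'I_N.+1}) (t : nat) :
  X != set0 -> minn N.+1 (#|X| + t) <= #|spread X t|.
Proof.
move=> X0; elim: t => [|t IHt].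
  rewrite addn0; apply: leq_trans (geq_minr _ _) _; apply: subset_leq_card.
  apply/subsetP=> x xX; rewrite inE; apply/existsP; exists x.
  by rewrite xX subrr.
pose S := spread X t.
have sS : S \subset spread X t.+1.
  apply/subsetP=> y; rewrite !inE => /existsP[x /andP[xX le]].
  by apply/existsP; exists x; rewrite xX leqW.
pose u : 'I_N.+1 := inZp 1.
have sS1 y : y \in S -> (y + u)%R \in spread X t.+1.
  rewrite !inE => /existsP[x /andP[xX le]]; apply/existsP; exists x; rewrite xX andTb.
  rewrite addrAC; apply: leq_trans (leq_mod ((y - x)%R + u) N.+1) _.
  by apply: leq_trans (leq_add le (leq_mod 1 N.+1)) _; rewrite addn1.
have [ST|] := boolP (spread X t.+1 \subset S); last first.
  move=> nS; have lt : #|spread X t| < #|spread X t.+1|.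
    by apply: proper_card; rewrite properE sS.
  lia.
have S0 : exists y, y \in S.
  by have /set0Pn[x xX] := X0; exists x; rewrite inE; apply/existsP; exists x; rewrite xX subrr.
have [y yS] := S0.
have all m : (y + inZp m)%R \in S.
  elim: m => [|m IHm].
    by rewrite (_ : inZp 0 = 0%R) ?addr0 //; apply: val_inj; rewrite /= mod0n.
  rewrite (_ : inZp m.+1 = inZp m + u)%R; last first.
    by apply: val_inj; rewrite /= modnDm addn1.
  by rewrite addrA (subsetP ST) // sS1.
suff -> : spread X t.+1 = setT by rewrite cardsT card_ord geq_minl.
apply/setP=> z; rewrite !in_setT; apply: (subsetP sS).
by have := all (z - y)%R; rewrite valZpK addrC subrK.
Qed.

Lemma arc_disjoint (N k l : nat) (i j : 'I_N.+1) :
  k <= (j - i)%R -> (j - i)%R + l <= N.+1 -> arc k i :&: arc l j = set0.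
Proof.
move=> kd dl; apply/eqP; rewrite -subset0; apply/subsetP=> x.
rewrite !inE => /andP[xi xj].
have : (x - i)%R = (x - j)%R + (j - i)%R :> nat.
  by rewrite -val_addr; [rewrite addrA subrK | lia].
lia.
Qed.

(** An [l]-arc starting between k and N + 1 - l steps past [i] misses [arc k i]. So [Y] avoids
    [spread X (N.+1 - l - k)] translated by [k], which [card_spread] makes large. *)
Lemma arcs_cross_bound (N k l : nat) (X Y : {set 'I_N.+1}) :
    0 < k -> k + l <= N.+1 -> X != set0 ->
    {in X & Y, forall i j, arc k i :&: arc l j != set0} ->
  #|Y| <= k + l - #|X|.
Proof.
move=> k0 kl X0 XY; have [l0 | l0] := posnP l.
  suff -> : Y = set0 by rewrite cards0.
  apply/eqP; rewrite -subset0; apply/subsetP=> j jY.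
  have /set0Pn[i iX] := X0; case/set0Pn: (XY i j iX jY) => x.
  by rewrite !inE l0 ltn0 andbF.
have kN : k < N.+1 by lia.
pose d : 'I_N.+1 := Ordinal kN.
pose S : {set 'I_N.+1} := [set (x + d)%R | x in spread X (N.+1 - l - k)].
have dis : [disjoint Y & S].
  apply/pred0P=> j; apply/negP=> /andP[jY /imsetP[y ys ej]].
  move: ys; rewrite inE => /existsP[i /andP[iX le]].
  have lt : (y - i)%R + k < N.+1.
    by apply: leq_ltn_trans (leq_add le (leqnn k)) _; lia.
  have ji : (j - i)%R = (y - i)%R + k :> nat.
    by rewrite ej addrAC; apply: (@val_addr N (y - i)%R d).
  have le' : (y - i)%R + k + l <= N.+1.
    by apply: leq_trans (leq_add (leq_add le (leqnn k)) (leqnn l)) _; lia.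
  by move: (XY i j iX jY); rewrite arc_disjoint ?eqxx // ji // leq_addl.
have cS : #|S| = #|spread X (N.+1 - l - k)| by rewrite card_imset //; apply: addIr.
have cU : #|Y :|: S| <= N.+1.
  by apply: leq_trans (max_card _) _; rewrite card_ord.
have eU : #|Y :|: S| = #|Y| + #|S| by apply/eqP; rewrite (leq_card_setU Y S).
have := card_spread (N.+1 - l - k) X0; rewrite -cS; lia.
Qed.

Lemma sum_arcs (N k : nat) (F : {set {set 'I_N.+1}}) :
    k <= N.+1 -> uniform k F ->
  (\sum_(s : {perm 'I_N.+1}) #|[set i | s @: arc k i \in F]|) * 'C(N.+1, k)
    = #|F| * (N.+1 * N.+1`!).
Proof.
move=> kN Fk.
have -> : \sum_(s : {perm 'I_N.+1}) #|[set i | s @: arc k i \in F]| =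
    \sum_(i < N.+1) #|[set s : {perm 'I_N.+1} | s @: arc k i \in F]|.
  under eq_bigr do rewrite -sum1dep_card big_mkcond.
  rewrite exchange_big /=; apply: eq_bigr => i _.
  by rewrite -sum1dep_card [RHS]big_mkcond.
rewrite big_distrl /= (eq_bigr (fun=> #|F| * N.+1`!)); last first.
  move=> i _; have := card_perm_imset_mem Fk (card_arc i kN).
  by rewrite card_ord.
by rewrite sum_nat_const card_ord mulnCA.
Qed.

(** For [F] equal to [G] this is the intersecting property; the pair [A] = [B] is included, so the
    empty set is ruled out. *)
Definition crossing (T : finType) (F G : {set {set T}}) : Prop :=
  {in F & G, forall A B, A :&: B != set0}.

Lemma crossing_arcs (N k l : nat) (F G : {set {set 'I_N.+1}})
    (s : {perm 'I_N.+1}) :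
    crossing F G ->
  {in [set i | s @: arc k i \in F] & [set j | s @: arc l j \in G],
    forall i j, arc k i :&: arc l j != set0}.
Proof.
move=> FG i j; rewrite !inE => iF jG; have := FG _ _ iF jG.
rewrite -imsetI; last by move=> x y _ _; apply: perm_inj.
by apply: contraNneq => ->; rewrite imset0.
Qed.

Lemma card_all_perm (T : finType) : #|{: {perm T}}| = #|T|`!.
Proof.
rewrite -[in RHS]cardsT -card_perm; apply: eq_card => s; rewrite !inE.
by apply/esym/subsetP=> x _; rewrite inE.
Qed.

(** A single permutation maps at most [k] of the N + 1 arcs into [F], by [arcs_cross_bound] with [X]
    equal to [Y]; averaging over permutations gives the bound. *)
Theorem erdos_ko_rado (N k : nat) (F : {set {set 'I_N.+1}}) :
    0 < k -> k.*2 <= N.+1 -> uniform k F -> crossing F F ->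
  #|F| <= 'C(N, k.-1).
Proof.
move=> k0 kN Fk FF; have kN' : k <= N.+1 by lia.
have := sum_arcs kN' Fk; set S := \sum_(s : _) _ => eqS.
have leS : S <= N.+1`! * k.
  rewrite -[N.+1]card_ord -card_all_perm -sum_nat_const; apply: leq_sum => s _.
  set X := [set i | _].
  have [X0 | X0] := eqVneq X set0; first by rewrite X0 cards0.
  have XX : #|X| <= k + k - #|X|.
    by apply: arcs_cross_bound (crossing_arcs FF) => //; rewrite addnn.
  lia.
have f0 := fact_gt0 N.+1.
have: #|F| * (N.+1 * N.+1`!) <= 'C(N, k.-1) * (N.+1 * N.+1`!).
  rewrite -eqS; apply: leq_trans (leq_mul leS (leqnn _)) _.
  have := mul_bin_diag N.+1 k.-1; rewrite prednK //= => eqC.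
  by rewrite -mulnA -eqC mulnC [N.+1 * 'C(_, _)]mulnC -mulnA.
by rewrite leq_pmul2r // muln_gt0.
Qed.

(** Arcs landing in [F] get weight N + 2 - r and arcs landing in [G] get weight r. As r C(N + 1, r)
    = (N + 2 - r) C(N + 1, r - 1), the sum over permutations is then proportional to #|F| + #|G|. *)
Lemma cross_intersecting_bound (N r : nat) (F G : {set {set 'I_N.+1}}) :
    0 < r -> r.*2 <= N.+2 -> r <= N ->
    uniform r F -> uniform r.-1 G -> crossing F F -> crossing F G ->
  #|F| + #|G| <= 'C(N.+1, r.-1).
Proof.
move=> r0 r2N rN Fr Gr FF FG.
have rN' : r <= N.+1 by lia.
have rN1 : r.-1 <= N.+1 by lia.
have eqF := sum_arcs rN' Fr; have eqG := sum_arcs rN1 Gr.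
have leS (s : {perm 'I_N.+1}) :
  #|[set i | s @: arc r i \in F]| * (N.+1 - r.-1) +
  r * #|[set i | s @: arc r.-1 i \in G]| <= r * N.+1.
  set X := [set i | _]; set Y := [set i | _].
  have [-> | X0] := eqVneq X set0.
    rewrite cards0 leq_mul //; apply: leq_trans (max_card _) _.
    by rewrite card_ord.
  have XY : #|Y| <= r + r.-1 - #|X|.
    by apply: arcs_cross_bound (crossing_arcs FG) => //; lia.
  have Xn : #|X| <= N.+1 by apply: leq_trans (max_card _) _; rewrite card_ord.
  (* If 2r <= N + 1, the bounds |X| <= r and |X| + |Y| <= 2r - 1 suffice. Otherwise 2r = N + 2: any
     two r-arcs meet, but the two weights coincide. *)
  have [r2 | r2] := leqP r.*2 N.+1.
    have XX : #|X| <= r + r - #|X|.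
      by apply: arcs_cross_bound (crossing_arcs FF) => //; lia.
    nia.
  have -> : N.+1 - r.-1 = r by lia.
  nia.
have sum_leS : (\sum_(s : {perm 'I_N.+1}) #|[set i | s @: arc r i \in F]|) * (N.+1 - r.-1)
    + r * \sum_(s : {perm 'I_N.+1}) #|[set i | s @: arc r.-1 i \in G]|
    <= N.+1`! * (r * N.+1).
  rewrite -(_ : #|{: {perm 'I_N.+1}}| = N.+1`!) -?sum_nat_const; last first.
    by rewrite card_all_perm card_ord.
  by rewrite big_distrl big_distrr -big_split /=; apply: leq_sum => s _.
move: sum_leS eqF eqG; set S := \sum_(s : _) _; set S' := \sum_(s : _) _ => sum_leS eqF eqG.
have eqC : r * 'C(N.+1, r) = (N.+1 - r.-1) * 'C(N.+1, r.-1).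
  by have := mul_bin_left N.+1 r.-1; rewrite prednK.
have f0 := fact_gt0 N.+1.
have c0 : 0 < r * (N.+1 * N.+1`!) by rewrite muln_gt0 r0 muln_gt0 f0.
rewrite -(leq_pmul2r c0).
have -> : (#|F| + #|G|) * (r * (N.+1 * N.+1`!)) =
    (S * (N.+1 - r.-1) + r * S') * 'C(N.+1, r.-1).
  rewrite !mulnDl -mulnA -eqC -mulnA eqG !(mulnCA _ r) eqF.
  by congr (_ + _).
rewrite [leqRHS]mulnC leq_mul2r; apply/orP; right.
by rewrite (leq_trans sum_leS) // mulnC -mulnA.
Qed.

(** * Weighted trace counts *)

(* [p k] counts the traces of size [k], [b] the root members; [e k] is the number
   of [k]-subsets of an [n]-set through a fixed point. *)
Lemma weighted_profile_bound (n r b : nat) (p e w : nat -> nat) :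
    0 < r -> r <= n ->
    (forall k, k.*2 <= n -> p k <= e k) ->
    (forall k, k <= n -> p k + p (n - k) <= e k + e (n - k)) ->
    {in [pred k | k <= n] &, {homo w : i j / i <= j >-> j <= i}} ->
    (forall k, r < k -> w k = 0) -> w r = 1 ->
    (r.*2 <= n.+1 -> p r + b <= e r + e r.-1) ->
    p (n - r.-1) + b <= e r.-1 + e (n - r.-1) ->
    (n.+2 <= r.*2 -> r.-1 + r.-1 != n -> w r.-1 < w (n - r.-1)) ->
    (r.-1 + r.-1 = n -> 0 < w r.-1) ->
  \sum_(k < n.+1) w k * p k + b <= \sum_(k < n.+1) w k * e k + e r.-1.
Proof.
move=> r0 rn E C mono w0 wr X D S1 S2.
have [r2 | r2] := leqP r.*2 n.+1.
  have rn1 : r < n.+1 by lia.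
  (* Size [r] is bounded together with [b]; smaller sizes satisfy 2k <= n, and larger ones have
     weight 0. *)
  rewrite (bigD1 (Ordinal rn1)) //= [X in _ <= X + _](bigD1 (Ordinal rn1)) //=.
  rewrite wr !mul1n addnAC [leqRHS]addnAC.
  apply: leq_add (X r2) _; apply: leq_sum => k /eqP kr.
  have [kr' | kr'] := leqP k r; last by rewrite w0.
  have ne : k <> r :> nat by move=> eq; apply: kr; apply: val_inj.
  by rewrite leq_mul2l E ?orbT //; lia.
(* For 2k <= n the common weight w (n - k) is charged to the bound on p k + p (n - k), and the
   excess of w k to the bound on p k. *)
have pair k : k <= n -> w k * p k + w (n - k) * p (n - k) <= w k * e k + w (n - k) * e (n - k).
  wlog k2 : k / k.*2 <= n => [H kn | kn].
    have [/H -> // | k2] := leqP k.*2 n.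
    have := H (n - k); rewrite subKn // => Hk.
    by rewrite addnC [leqRHS]addnC Hk //; lia.
  have wk : w (n - k) <= w k by apply: mono; rewrite ?inE; lia.
  rewrite -(subnKC wk) !mulnDl -!addnA ![_ + w (n - k) * _]addnC !addnA -!mulnDr.
  by apply: leq_add; rewrite leq_mul2l ?C ?E ?orbT.
(* The sum is doubled below by adding its reversal, so [b] must be counted twice: once at each of r
   - 1 and n - r + 1, or twice at one place if they agree. *)
pose d k := (k == r.-1) + (k == n - r.-1).
have pairb k : k <= n -> w k * p k + w (n - k) * p (n - k) + d k * b
   <= w k * e k + w (n - k) * e (n - k) + d k * e r.-1.
  move=> kn; have [m1 rm] : r.-1 <= n /\ (n - r.-1).*2 <= n by lia.
  (* The strict inequality of weights leaves a spare unit on size n - r + 1, which pays for [b]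
     through [D]. *)
  have big : r.-1 + r.-1 != n ->
    w r.-1 * p r.-1 + w (n - r.-1) * p (n - r.-1) + b
    <= w r.-1 * e r.-1 + w (n - r.-1) * e (n - r.-1) + e r.-1.
    move=> /(S1 r2) wlt.
    rewrite -(subnKC wlt) -addn1 !mulnDl !mul1n.
    have := leq_mul (leqnn (w r.-1)) (C _ m1); rewrite !mulnDr.
    have := leq_mul (leqnn (w (n - r.-1) - (w r.-1 + 1))) (E _ rm).
    move: D; lia.
  rewrite /d; have [ek | nk] := eqVneq k r.-1.
    rewrite ek; have [em | nm] := eqVneq r.-1 (n - r.-1).
      have wp : 0 < w r.-1 by apply: S2; lia.
      rewrite -em in D *; rewrite -(prednK wp) !mulSn.
      have := leq_mul (leqnn (w r.-1).-1) (E r.-1 ltac:(lia)).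
      move: D; lia.
    by rewrite addn0 !mul1n; apply: big; lia.
  have [ek | _] := eqVneq k (n - r.-1); last by rewrite !addn0 pair.
  rewrite ek subKn // !mul1n [w (n - _) * p _ + _]addnC [w (n - _) * e _ + _]addnC.
  by apply: big; lia.
have dbl (f : nat -> nat) : (\sum_(k < n.+1) f k).*2 = \sum_(k < n.+1) (f k + f (n - k)).
  rewrite big_split /= -addnn; congr (_ + _).
  by rewrite (reindex_inj rev_ord_inj); apply: eq_bigr => k _; rewrite /= subSS.
have sumd c : \sum_(k < n.+1) d k * c = c.*2.
  have one m : m <= n -> \sum_(k < n.+1) (val k == m) * c = c.
    rewrite -ltnS => mn; rewrite (bigD1 (Ordinal mn)) //= eqxx mul1n big1 ?addn0 // => k.
    by rewrite -val_eqE /= => /negPf->.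
  under eq_bigr do rewrite mulnDl.
  by rewrite big_split /= !one -?addnn //; lia.
rewrite -leq_double !doubleD (dbl (fun k => w k * p k)) (dbl (fun k => w k * e k)).
rewrite -!sumd -!big_split /=.
by apply: leq_sum => k _; apply: pairb; rewrite -ltnS.
Qed.

(** The case split matters at 0, where ['C(N, k.-1)] would be 1. *)
Definition through_count (N k : nat) : nat := if k is k'.+1 then 'C(N, k') else 0.

Lemma card_sets_through (N k : nat) (j : 'I_N.+1) :
  #|[set Q : {set 'I_N.+1} | (#|Q| == k) && (j \in Q)]| = through_count N k.
Proof.
have := card_draws 'I_N.+1 k; rewrite card_ord.
rewrite -(cardsID [set Q : {set 'I_N.+1} | j \in Q]).
have -> : #|[set A : {set 'I_N.+1} | #|A| == k] :\: [set Q : {set 'I_N.+1} | j \in Q]| = 'C(N, k).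
  rewrite -[N in RHS](_ : #|~: [set j]| = N); last by rewrite cardsC1 card_ord.
  rewrite -cards_draws; apply: eq_card => Q; rewrite !inE; congr (_ && _).
  by rewrite -disjoints_subset disjoint_sym disjoints1.
rewrite -[_ :&: _](_ : [set Q : {set 'I_N.+1} | (#|Q| == k) && (j \in Q)] = _); last first.
  by apply/setP=> Q; rewrite !inE.
by case: k => [|k]; rewrite ?bin0 ?binS /=; lia.
Qed.

Lemma through_count_compl (N k : nat) : k <= N.+1 ->
  through_count N k + through_count N (N.+1 - k) = 'C(N.+1, k).
Proof.
case: k => [|k] kN; first by rewrite subn0 /= binn bin0.
rewrite subSS binS /= addnC; congr (_ + _).
case: (leqP N k) => kN'; first by rewrite (_ : N - k = 0) ?bin_small //=; lia.
by rewrite -(bin_sub kN') (_ : N - k = (N - k.+1).+1) //; lia.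
Qed.

Lemma sum_by_card (n : nat) (w : nat -> nat) (PP : {set {set 'I_n}}) :
  \sum_(P in PP) w #|P| = \sum_(k < n.+1) w k * #|[set P in PP | #|P| == k]|.
Proof.
have cn (P : {set 'I_n}) : #|P| < n.+1.
  by rewrite ltnS; apply: leq_trans (max_card _) _; rewrite card_ord.
rewrite (partition_big (fun P => Ordinal (cn P)) xpredT) //=.
apply: eq_bigr => k _; rewrite mulnC -sum1dep_card big_distrl /=.
rewrite (eq_bigl (fun P => (P \in PP) && (#|P| == k))); last by move=> P.
by apply: eq_bigr => P /andP[_ /eqP->]; rewrite mul1n.
Qed.

(** * Independent sets and shifts in the claw *)

Section Claw.
Variable n : nat.
Implicit Types (A B : {set claw_vertex n}) (P Q D : {set 'I_n}) (c : bool).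
Implicit Types F : {set {set claw_vertex n}}.

Definition claw_set c P D : {set claw_vertex n} :=
  [set x | match x with
           | None => c | Some (inl i) => i \in D | Some (inr i) => i \in P
           end].

Definition leaves A : {set 'I_n} := [set i | Some (inr i) \in A].
Definition inners A : {set 'I_n} := [set i | Some (inl i) \in A].

Lemma claw_setK A : claw_set (None \in A) (leaves A) (inners A) = A.
Proof. by apply/setP=> [[[i|i]|]]; rewrite !inE. Qed.

Lemma root_claw_set c P D : (None \in claw_set c P D) = c.
Proof. by rewrite inE. Qed.

Lemma leaves_claw_set c P D : leaves (claw_set c P D) = P.
Proof. by apply/setP=> i; rewrite !inE. Qed.

Lemma inners_claw_set c P D : inners (claw_set c P D) = D.
Proof. by apply/setP=> i; rewrite !inE. Qed.

Lemma claw_setI c P D c' P' D' :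
  claw_set c P D :&: claw_set c' P' D' = claw_set (c && c') (P :&: P') (D :&: D').
Proof. by apply/setP=> [[[i|i]|]]; rewrite !inE. Qed.

Lemma claw_set_eq0 c P D :
  (claw_set c P D == set0) = [&& ~~ c, P == set0 & D == set0].
Proof.
apply/eqP/and3P => [e0 | [/negPf-> /eqP-> /eqP->]]; last first.
  by apply/setP=> [[[i|i]|]]; rewrite !inE.
have := root_claw_set c P D; have := leaves_claw_set c P D.
have := inners_claw_set c P D; rewrite e0 in_set0 => <- <- <-.
by split=> //; apply/eqP/setP=> i; rewrite !inE.
Qed.

Lemma meets_claw A B :
  (A :&: B != set0) = [|| (None \in A) && (None \in B),
    leaves A :&: leaves B != set0 | inners A :&: inners B != set0].
Proof.
by rewrite -{1}(claw_setK A) -{1}(claw_setK B) claw_setI claw_set_eq0 negb_and negbK negb_and.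
Qed.

Lemma card_claw_set c P D : #|claw_set c P D| = c + #|P| + #|D|.
Proof.
have -> : claw_set c P D = [set x | c && (x == None)] :|:
    (fun i => Some (inr i)) @: P :|: (fun i => Some (inl i)) @: D.
  apply/setP=> [[[i|i]|]]; rewrite !inE.
  - rewrite andbF /= mem_imset; last by move=> x y [].
    by rewrite [X in X || _](_ : _ = false) ?orbF //; apply/negbTE/imsetP=> [[]].
  - rewrite andbF /= mem_imset; last by move=> x y [].
    by rewrite [X in _ || X](_ : _ = false) ?orbF //; apply/negbTE/imsetP=> [[]].
  rewrite eqxx andbT; case: c => //=.
  by apply/esym/negbTE; rewrite negb_or; apply/andP; split; apply/imsetP=> [[]].
rewrite !cardsU !card_imset; try by move=> x y [].
rewrite [X in _ - #|pred_of_set X|](_ : _ = set0); last first.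
  apply/setP=> x; rewrite !inE; apply/negP=> /andP[/orP[/andP[_ /eqP->]|/imsetP[i _ ->]]];
  by case/imsetP.
rewrite [X in _ + _ - #|pred_of_set X| + _](_ : _ = set0); last first.
  by apply/setP=> x; rewrite !inE; apply/negP=> /andP[/andP[_ /eqP->]] /imsetP[].
rewrite cards0 !subn0; congr (_ + _ + _).
case: c; first by rewrite -[RHS](cards1 (None : claw_vertex n)); apply: eq_card => x; rewrite !inE.
by apply: eq_card0 => x; rewrite !inE.
Qed.

Lemma independent_claw A : independent (@claw_adj n) A =
  (leaves A :&: inners A == set0) && ((None \in A) ==> (inners A == set0)).
Proof.
rewrite /independent; apply/idP/andP=> [indA | [/eqP d0 rootA]].
  have ind x y : x \in A -> y \in A -> ~~ claw_adj x y.
    by move=> xA yA; have /forall_inP/(_ _ xA)/forall_inP/(_ _ yA) := indA.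
  split; last apply/implyP=> cA.
    rewrite -subset0; apply/subsetP=> i; rewrite !inE => /andP[iA iB].
    by have := ind _ _ iA iB; rewrite /= eqxx.
  rewrite -subset0; apply/subsetP=> i; rewrite !inE => iB.
  by have := ind _ _ cA iB.
have dis i : Some (inr i) \in A -> Some (inl i) \in A -> False.
  by move=> iA iB; have /setP/(_ i) := d0; rewrite !inE iA iB.
have cdis i : None \in A -> Some (inl i) \in A -> False.
  move=> cA iB; have /eqP/setP/(_ i) := implyP rootA cA.
  by rewrite !inE iB.
apply/forall_inP=> x xA; apply/forall_inP=> y yA.
apply/negP; move: x y xA yA => [[i|i]|] [[j|j]|] //= xA yA.
- by move/eqP=> ij; rewrite ij in xA; apply: dis _ yA xA.
- by move=> _; apply: cdis _ yA xA.
- by move/eqP=> ij; rewrite ij in xA; apply: dis _ xA yA.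
- by move=> _; apply: cdis _ xA yA.
Qed.

Lemma claw_indepP r A :
  reflect [/\ leaves A :&: inners A = set0, None \in A -> inners A = set0 &
             (None \in A) + #|leaves A| + #|inners A| = r]
    (A \in indep_sets (@claw_adj n) r).
Proof.
have cA : #|A| = (None \in A) + #|leaves A| + #|inners A|.
  by rewrite -{1}(claw_setK A) card_claw_set.
rewrite inE independent_claw cA.
apply: (iffP idP) => [/andP[/andP[/eqP d /implyP c] /eqP s]|[-> c ->]].
  by split=> // /c/eqP.
by rewrite !eqxx andbT /=; apply/implyP=> /c->.
Qed.

Lemma claw_set_indep r c P D : P :&: D = set0 -> (c -> D = set0) ->
  c + #|P| + #|D| = r -> claw_set c P D \in indep_sets (@claw_adj n) r.
Proof.
move=> PD cD s; apply/claw_indepP.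
by rewrite root_claw_set leaves_claw_set inners_claw_set.
Qed.

(** Any family of independent [r]-sets lies in the span of its own traces, and a leaf star is such a
    span, so counting spans bounds the former and computes the latter. *)
Definition claw_span r (PP QQ : {set {set 'I_n}}) :=
  [set A in indep_sets (@claw_adj n) r |
     if None \in A then leaves A \in QQ else leaves A \in PP].

Lemma card_claw_span r PP QQ : 0 < r <= n -> uniform r.-1 QQ ->
  #|claw_span r PP QQ| = \sum_(P in PP) 'C(n - #|P|, n - r) + #|QQ|.
Proof.
move=> /andP[r0 rn] Qr.
rewrite -(cardsID [set A : {set claw_vertex n} | None \in A]) addnC; congr (_ + _); last first.
  rewrite -(card_imset _ (can_inj (fun Q => leaves_claw_set true Q set0))).
  apply: eq_card => A; apply/idP/imsetP => [|[Q QQQ ->]].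
    rewrite !inE => /andP[/andP[Ar]] /[swap] cA; rewrite cA => AQ.
    exists (leaves A) => //.
    have /claw_indepP[_ /(_ cA) <- _] : A \in indep_sets (@claw_adj n) r by rewrite inE.
    by rewrite -[LHS]claw_setK cA.
  rewrite in_setI [X in _ && X]in_set root_claw_set andbT.
  rewrite in_set root_claw_set leaves_claw_set QQQ andbT.
  by apply: claw_set_indep; rewrite ?setI0 ?cards0 ?Qr //; lia.
rewrite -sum1_card (partition_big leaves (mem PP)) /=; last first.
  by move=> A; rewrite !inE; case: (None \in A) => //= /andP[].
apply: eq_bigr => P PPP; rewrite sum1dep_card.
have -> : n - #|P| = #|~: P| by rewrite [RHS]cardsCs setCK card_ord.
rewrite -cards_draws.
pose f E := claw_set false P (~: (P :|: E)).
rewrite -(card_in_imset (f := f)); last first.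
  move=> E E'; rewrite !inE => /andP[sE _] /andP[sE' _] /(congr1 inners).
  rewrite !inners_claw_set => /setC_inj eqU.
  have id (X : {set _}) : X \subset ~: P -> X = (P :|: X) :\: P.
    by move=> sX; rewrite setDUl setDv set0U; apply/esym/setDidPl; rewrite disjoints_subset.
  by rewrite (id _ sE) (id _ sE') eqU.
apply: eq_card => A; apply/idP/imsetP => [|[E]].
  rewrite !inE; case cA : (None \in A) => //= /andP[/andP[Ar _] /eqP PA].
  have /claw_indepP[d _ s] : A \in indep_sets (@claw_adj n) r by rewrite inE.
  exists (~: (P :|: inners A)); last first.
    rewrite /f -[LHS]claw_setK cA PA; congr claw_set.
    rewrite setCU setCK setIUr setIC setICr set0U setIC.
    by apply/esym/setIidPl; rewrite -disjoints_subset -setI_eq0 setIC -PA d.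
  rewrite inE setCU subsetIl -setCU cardsCs setCK card_ord -PA cardsU d cards0 subn0.
  by move: s; rewrite cA add0n => ->; rewrite eqxx.
rewrite inE => /andP[sE /eqP cE] ->.
have dPE : [disjoint P & E] by rewrite disjoint_sym disjoints_subset.
rewrite in_set; apply/andP; split; last by rewrite leaves_claw_set.
rewrite in_setD in_set root_claw_set /= in_set root_claw_set leaves_claw_set PPP andbT.
apply: claw_set_indep => //; first by rewrite setCU setIA setICr set0I.
have := cardsC (P :|: E); rewrite card_ord cardsU disjoint_setI0 // cards0 cE; lia.
Qed.

Lemma star_leaf_span r j :
  star (@claw_adj n) r (Some (inr j)) =
  claw_span r [set P : {set _} | j \in P] [set Q : {set _} | (#|Q| == r.-1) && (j \in Q)].
Proof.
apply/setP=> A; rewrite [LHS]in_set [RHS]in_set.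
have [/claw_indepP[_ cD s]|] //= := boolP (A \in indep_sets _ r).
rewrite !inE; case cA : (None \in A) => //.
by rewrite -s cD // cA cards0 addn0 add1n eqxx.
Qed.

(** * Shifting inner vertices to leaves *)

Definition shift i A : {set claw_vertex n} :=
  claw_set (None \in A) (if i \in inners A then i |: leaves A else leaves A)
    (inners A :\ i).

Definition shift_in F i A := if shift i A \in F then A else shift i A.

Definition shift_family i F := shift_in F i @: F.

Lemma shift_id i A : i \notin inners A -> shift i A = A.
Proof.
move=> iD; rewrite -[RHS]claw_setK /shift (negPf iD); congr claw_set.
by apply/setDidPl; rewrite disjoints_subset subsetC sub1set inE.
Qed.

Lemma inners_shift i A : inners (shift i A) = inners A :\ i.
Proof. exact: inners_claw_set. Qed.

Lemma leaves_shift i A : leaves (shift i A) =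
  if i \in inners A then i |: leaves A else leaves A.
Proof. exact: leaves_claw_set. Qed.

Lemma root_shift i A : (None \in shift i A) = (None \in A).
Proof. exact: root_claw_set. Qed.

Lemma shift_indep r i A : A \in indep_sets (@claw_adj n) r ->
  shift i A \in indep_sets (@claw_adj n) r.
Proof.
have [iD | /shift_id-> //] := boolP (i \in inners A).
move=> /claw_indepP[d cD s]; apply/claw_indepP.
rewrite inners_shift leaves_shift root_shift iD; split.
- apply/setP=> x; have /setP/(_ x) := d.
  by rewrite !in_setI !in_setU1 in_setD1 in_set0; case: eqP.
- by move=> /cD ->; rewrite set0D.
have iP : i \notin leaves A.
  by have /setP/(_ i) := d; rewrite in_setI iD andbT in_set0 => ->.
by rewrite cardsU1 iP -s (cardsD1 i (inners A)) iD; lia.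
Qed.

(** A moved member contained b_i and lacked a_i, so the move can be undone; it lands outside [F],
    away from the unmoved members. *)
Lemma shift_in_inj r i F : F \subset indep_sets (@claw_adj n) r ->
  {in F &, injective (shift_in F i)}.
Proof.
move=> /subsetP sF.
have moved A : A \in F -> shift i A \notin F -> i \in inners A /\ i \notin leaves A.
  move=> AF nF; have iD : i \in inners A.
    by apply: contraNT nF => /shift_id->.
  split=> //; have /claw_indepP[/setP/(_ i) d _ _] := sF _ AF.
  by move: d; rewrite in_setI iD andbT in_set0 => ->.
move=> A B AF BF; rewrite /shift_in.
case: ifPn => AS; case: ifPn => BS // eqAB.
- by rewrite -eqAB AF in BS.
- by rewrite eqAB BF in AS.
have [iA iA'] := moved _ AF AS; have [iB iB'] := moved _ BF BS.
rewrite -(claw_setK A) -(claw_setK B) -(root_shift i A) -(root_shift i B) eqAB.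
congr claw_set.
  move/(congr1 leaves): eqAB; rewrite !leaves_shift iA iB => eqL.
  by rewrite -(setU1K iA') eqL setU1K.
move/(congr1 inners): eqAB; rewrite !inners_shift => eqD.
by rewrite -(setD1K iA) eqD setD1K.
Qed.

Lemma card_shift_family r i F : F \subset indep_sets (@claw_adj n) r ->
  #|shift_family i F| = #|F|.
Proof. by move=> sF; apply/card_in_imset/(shift_in_inj sF). Qed.

Lemma shift_family_indep r i F : F \subset indep_sets (@claw_adj n) r ->
  shift_family i F \subset indep_sets (@claw_adj n) r.
Proof.
move=> /subsetP sF; apply/subsetP=> _ /imsetP[A AF ->].
by rewrite /shift_in; case: ifP => _; [|apply: shift_indep]; apply: sF.
Qed.

Lemma intersectingP (T : finType) (G : {set {set T}}) :
  reflect (crossing G G) (intersecting G).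
Proof.
apply: (iffP idP) => [iG A B AG BG | iG].
  by have /forall_inP/(_ _ AG)/forall_inP/(_ _ BG) := iG.
by apply/forall_inP=> A AG; apply/forall_inP=> B BG; apply: iG.
Qed.

(** Two moved members share a_i. If [A] moves and [B] stays, then [shift i B] is in [F] and meets
    [A]; as [A] lacks a_i and [shift i B] lacks b_i, the common vertex is neither, and it survives
    in [shift i A] and [B]. *)
Lemma shift_family_intersecting r i F : F \subset indep_sets (@claw_adj n) r ->
  intersecting F -> intersecting (shift_family i F).
Proof.
move=> /subsetP sF /intersectingP iF; apply/intersectingP.
have one A B : A \in F -> B \in F -> shift i A \notin F -> shift i B \in F ->
    shift i A :&: B != set0.
  move=> AF BF AS BS; have iA : i \in inners A.
    by apply: contraNT AS => /shift_id->.
  have /claw_indepP[/setP/(_ i) d _ _] := sF _ AF.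
  have iP : i \notin leaves A by move: d; rewrite in_setI iA andbT in_set0 => ->.
  have := iF _ _ AF BS; rewrite !meets_claw root_shift leaves_shift inners_shift.
  rewrite root_shift leaves_shift inners_shift iA.
  case/or3P=> [-> // | /set0Pn[x] | /set0Pn[x]].
    rewrite in_setI => /andP[xA xB]; apply/or3P/Or32/set0Pn; exists x.
    have xi : x != i by apply: contraNneq iP => <-.
    move: xB; case: ifP => _; rewrite !in_setI !in_setU1 xA orbT //=.
    by rewrite (negPf xi).
  rewrite in_setI => /andP[xA]; rewrite in_setD1 => /andP[xi xB].
  by apply/or3P/Or33/set0Pn; exists x; rewrite in_setI in_setD1 xi xA.
move=> _ _ /imsetP[A AF ->] /imsetP[B BF ->]; rewrite /shift_in.
case: ifPn => AS; case: ifPn => BS.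
- exact: iF.
- by rewrite setIC one.
- exact: one.
have iA : i \in inners A by apply: contraNT AS => /shift_id->.
have iB : i \in inners B by apply: contraNT BS => /shift_id->.
rewrite meets_claw !leaves_shift iA iB; apply/or3P/Or32/set0Pn; exists i.
by rewrite in_setI !setU11.
Qed.

(** Termination measure: a shift that changes the family trades some b_i for a_i and adds no inner
    vertex. *)
Definition inner_weight F := \sum_(A in F) #|inners A|.

Lemma inner_weight_shift r i F A : F \subset indep_sets (@claw_adj n) r ->
  A \in F -> shift i A \notin F -> inner_weight (shift_family i F) < inner_weight F.
Proof.
move=> sF AF AS; rewrite /inner_weight big_imset /=; last exact: shift_in_inj sF.
rewrite (bigD1 A AF) [ltnRHS](bigD1 A AF) /= -addSn; apply: leq_add.
  have iA : i \in inners A by apply: contraNT AS => /shift_id->.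
  by rewrite /shift_in (negPf AS) inners_shift (cardsD1 i (inners A)) iA.
apply: leq_sum => B _; rewrite /shift_in; case: ifP => // _.
by rewrite inners_shift subset_leq_card // subsetDl.
Qed.

Definition compressed F := [forall i, forall A in F, shift i A \in F].

(** Induction on the common inner vertices: if b_i is shared, replace [B] by [shift i B]. Since [A]
    lacks a_i, the leaves shared with [A] do not change. *)
Lemma compressed_meet r F A B : F \subset indep_sets (@claw_adj n) r ->
    intersecting F -> compressed F -> A \in F -> B \in F ->
  (None \in A) && (None \in B) || (leaves A :&: leaves B != set0).
Proof.
move=> /subsetP sF /intersectingP iF /forallP cF AF.
have [m] := ubnP #|inners A :&: inners B|; elim: m B => // m IHm B ltm BF.
have /claw_indepP[dA _ _] := sF _ AF.
have := iF _ _ AF BF; rewrite meets_claw orbA => /orP[// | /set0Pn[i]].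
rewrite in_setI => /andP[iA iB].
have BS : shift i B \in F by have /forall_inP := cF i; apply.
have iP : i \notin leaves A.
  by have /setP/(_ i) := dA; rewrite in_setI iA andbT in_set0 => ->.
have := IHm _ _ BS; rewrite root_shift leaves_shift inners_shift iB.
rewrite setIUr (_ : leaves A :&: [set i] = set0) ?set0U; first apply.
  rewrite setIDA; move: ltm; rewrite (cardsD1 i (_ :&: _)) in_setI iA iB; lia.
apply/setP=> x; rewrite !in_setI in_set1 in_set0; case: eqP => [->|_].
  by rewrite (negPf iP).
by rewrite andbF.
Qed.
End Claw.

(** * The leaf star as extremal trace count *)

Definition leaf_star_size (N r : nat) : nat :=
  \sum_(k < N.+2) 'C(N.+1 - k, N.+1 - r) * through_count N k + through_count N r.-1.

Lemma card_star_leaf (N r : nat) (j : 'I_N.+1) : 0 < r <= N.+1 ->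
  #|star (@claw_adj N.+1) r (Some (inr j))| = leaf_star_size N r.
Proof.
move=> rN; rewrite star_leaf_span card_claw_span //; last first.
  by move=> Q; rewrite in_set => /andP[/eqP].
rewrite card_sets_through (sum_by_card (fun k => 'C(N.+1 - k, N.+1 - r))).
congr (_ + _); apply: eq_bigr => k _; rewrite -(card_sets_through k j).
by congr (_ * _); apply: eq_card => P; rewrite !inE andbC.
Qed.

(** No member of [F] is the complement of a member of [G], so [F] and the complements of [G] are
    disjoint families of [k]-sets. *)
Lemma crossing_compl_bound (n k : nat) (F G : {set {set 'I_n}}) :
    k <= n -> uniform k F -> uniform (n - k) G -> crossing F G ->
  #|F| + #|G| <= 'C(n, k).
Proof.
move=> kn Fk Gk FG; have -> : #|G| = #|[set ~: B | B in G]|.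
  by rewrite card_imset //; apply: setC_inj.
rewrite -[n in 'C(n, k)]card_ord -card_draws.
have <- : #|F :|: [set ~: B | B in G]| = #|F| + #|[set ~: B | B in G]|.
  apply/eqP; rewrite (leq_card_setU F [set ~: B | B in G]); apply/pred0P=> A.
  apply/negP=> /andP[/= AF /imsetP[B BG eqA]].
  by have := FG _ _ AF BG; rewrite eqA setIC setICr eqxx.
apply: subset_leq_card; apply/subsetP=> A; rewrite !inE.
case/orP=> [/Fk-> // | /imsetP[B /Gk cB ->]].
by rewrite cardsCs setCK card_ord cB subKn.
Qed.

Lemma leaf_star_size_bound (N r b : nat) (p : nat -> nat) :
    0 < r <= N ->
    (forall k, k.*2 <= N.+1 -> p k <= through_count N k) ->
    (forall k, k <= N.+1 -> p k + p (N.+1 - k) <= 'C(N.+1, k)) ->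
    (r.*2 <= N.+2 -> p r + b <= 'C(N.+1, r.-1)) ->
    p (N.+1 - r.-1) + b <= 'C(N.+1, r.-1) ->
  \sum_(k < N.+2) 'C(N.+1 - k, N.+1 - r) * p k + b <= leaf_star_size N r.
Proof.
move=> /andP[r0 rN] E C X D.
apply: (weighted_profile_bound (w := fun k => 'C(N.+1 - k, N.+1 - r)) r0) => //.
- exact: leqW.
- by move=> k kN; rewrite through_count_compl // C.
- by move=> i j iN jN ij; rewrite leq_bin2l // leq_sub2l.
- by move=> k rk; rewrite bin_small //; lia.
- by rewrite binn.
- move=> r2; apply: leq_trans (X r2) _.
  by case: (r) r0 => [|[|r']] // _; rewrite /= ?bin0 ?binS.
- by rewrite through_count_compl //; lia.
(* Put t = N + 1 - r. The weights are t + 1 and C(r - 1, t), where t >= 1 and r - 1 >= t + 2; and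
   C(t + 2, t) = C(t + 1, 2) + t + 1 exceeds t + 1. *)
- move=> r2 ne; have e1 : N.+1 - r.-1 = (N.+1 - r).+1 by lia.
  have e2 : N.+1 - (N.+1 - r.-1) = r.-1 by lia.
  have [t0 t2] : 0 < N.+1 - r /\ (N.+1 - r).+2 <= r.-1 by lia.
  rewrite e2 e1; move: (N.+1 - r) t0 t2 {e1 e2} => t t0 t2.
  rewrite binSn; apply: leq_trans (leq_bin2l t t2).
  rewrite -(@bin_sub t.+2 t) ?(leqW (leqnSn _)) // -addn2 addKn bin2 addn2.
  by rewrite -bin2 binS bin1 -[ltnLHS]add0n ltn_add2r bin_gt0.
- by move=> _; rewrite bin_gt0; lia.
Qed.

(** * From compressed families back to all families *)

(** The sizes agree, so it suffices that every member of [F] contains a_j. Only the shift at [j] can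
    create a_j, which leaves the case of a member with b_j. *)
Lemma shift_family_star n r (i j : 'I_n) (F : {set {set claw_vertex n}}) :
    1 < r < n -> F \subset indep_sets (@claw_adj n) r -> intersecting F ->
    shift_family i F = star (@claw_adj n) r (Some (inr j)) ->
  F = star (@claw_adj n) r (Some (inr j)).
Proof.
move=> /andP[r1 rn] sF iF eqS; apply/eqP.
rewrite eqEcard -eqS (card_shift_family i sF) leqnn andbT eqS.
apply/subsetP=> A AF; rewrite in_set (subsetP sF) //=.
have indep := subsetP sF.
have : j \in leaves (shift_in F i A).
  have : shift_in F i A \in star (@claw_adj n) r (Some (inr j)).
    by rewrite -eqS imset_f.
  by rewrite !in_set => /andP[].
rewrite /shift_in; case: ifP => _; first by rewrite in_set.
rewrite leaves_shift; case: ifPn => iA; last by rewrite in_set.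
rewrite in_setU1 => /orP[/eqP ji | ]; last by rewrite in_set.
exfalso; subst i; move: A AF iA => A.
(* Of the two preimages of a member of the star, the one with [a_j] and the one
   with [b_j], exactly one is in [F]. So if [Z] with [b_j] is in [F], a star
   member [W] disjoint from [Z] occurs in [F] with [b_j] for [a_j]. Two such
   steps trade a leaf [a_p] of [Z] for a [b_e] outside the support of [Z]; once
   no leaf is left, [Z] misses the root members of the star, which are in [F]. *)
have alt c (P D : {set 'I_n}) : j \in P -> claw_set c P D \in indep_sets (@claw_adj n) r ->
    claw_set c P D \notin F -> claw_set c (P :\ j) (j |: D) \in F.
  move=> jP ind nF.
  have : claw_set c P D \in star (@claw_adj n) r (Some (inr j)).
    by rewrite in_set ind in_set.
  rewrite -eqS => /imsetP[Z ZF]; rewrite /shift_in.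
  case: ifPn => ZS eqZ; first by rewrite eqZ ZF in nF.
  have jZ : j \in inners Z by apply: contraNT ZS => /shift_id->.
  have /claw_indepP[/setP/(_ j) d _ _] := indep _ ZF.
  have jZ' : j \notin leaves Z by move: d; rewrite in_setI jZ andbT in_set0 => ->.
  have := congr1 (@leaves n) eqZ; rewrite leaves_claw_set leaves_shift jZ => ->.
  have := congr1 (@inners n) eqZ; rewrite inners_claw_set inners_shift => ->.
  have := root_shift j Z; rewrite -eqZ root_claw_set => ->.
  by rewrite setU1K // setD1K // claw_setK.
have [m] := ubnP #|leaves A|; elim: m A => // m IHm A ltm AF jD.
have /claw_indepP[dA cA sA] := indep _ AF.
have rootA : (None \in A) = false.
  by apply/negP=> /cA/setP/(_ j); rewrite jD in_set0.
have [P0 | [p pP]] := set_0Vmem (leaves A).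
  have : 0 < #|[set Y : {set 'I_n} | Y \subset ~: [set j] & #|Y| == r.-2]|.
    by rewrite cards_draws bin_gt0 cardsC1 card_ord; lia.
  case/card_gt0P=> Y; rewrite in_set => /andP[/subsetP sY /eqP cY].
  have jY : j \notin Y by apply/negP=> /sY; rewrite !inE eqxx.
  have ind : claw_set true (j |: Y) set0 \in indep_sets (@claw_adj n) r.
    by apply: claw_set_indep; rewrite ?setI0 // cards0 cardsU1 jY cY; lia.
  have [inF | nF] := boolP (claw_set true (j |: Y) set0 \in F).
    have /intersectingP/(_ _ _ AF inF) := iF.
    by rewrite meets_claw rootA P0 inners_claw_set set0I setI0 eqxx.
  have /indep/claw_indepP[_] := alt _ _ _ (setU11 _ _) ind nF.
  by rewrite root_claw_set inners_claw_set => /(_ isT)/setP/(_ j); rewrite !inE eqxx.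
have EA : A = claw_set false (leaves A) (inners A) by rewrite -[LHS]claw_setK rootA.
move: (leaves A) (inners A) EA dA pP sA ltm jD {cA} => P D EA dA pP sA ltm jD.
have dis x : x \in P -> x \in D = false.
  by move=> xP; have /setP/(_ x) := dA; rewrite in_setI xP in_set0.
have cPD : #|P :|: D| = r by rewrite cardsU dA cards0 subn0 -sA rootA.
(* Here r < n leaves an index used by neither [P] nor [D]. *)
have : 0 < #|~: (P :|: D)|.
  by have := cardsC (P :|: D); rewrite card_ord cPD; lia.
case/card_gt0P=> e; rewrite !inE negb_or => /andP[eP eD].
have nmeet Z W : Z \in F -> W \in F -> Z :&: W = set0 -> False.
  by move=> ZF WF eq0; have /intersectingP/(_ _ _ ZF WF) := iF; rewrite eq0 eqxx.
(* The mirror image of [A], leaves and inner vertices exchanged, contains a_j and misses [A]; so it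
   is not in [F], and its variant with b_j is. *)
have VF : claw_set false (D :\ j) (j |: P) \in F.
  apply: alt => //.
    by apply: claw_set_indep; rewrite // 1?setIC // -sA rootA; lia.
  apply/negP=> WF; apply: nmeet AF WF _; rewrite EA claw_setI [D :&: P]setIC dA.
  by apply/eqP; rewrite claw_set_eq0 eqxx.
have jP : j \notin P by apply: contraTN jD => /dis->.
have jp : j != p by apply: contraNneq jP => ->.
have ej : e != j by apply: contraNneq eD => ->.
(* The star member with leaves [j |: P :\ p] and inner vertices [e |: D :\ j] misses the set of
   [VF], so its variant with b_j is in [F] and has one leaf fewer than [A]. *)
have : claw_set false ((j |: P :\ p) :\ j) (j |: (e |: D :\ j)) \in F.
  apply: alt; first exact: setU11.
    apply: claw_set_indep => //.
      apply/setP=> x; rewrite !inE; case: (x =P j) => [->|_] /=.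
        by rewrite orbF eq_sym (negPf ej).
      case: (x =P e) => [->|_] /=; first by rewrite (negPf eP) andbF.
      by case xP : (x \in P); rewrite ?andbF // (dis _ xP) andbF.
    rewrite !cardsU1 !in_setD1 (negPf jP) (negPf eD) !andbF.
    by move: sA; rewrite rootA (cardsD1 p P) pP (cardsD1 j D) jD.
  apply/negP=> WF; apply: nmeet VF WF _; rewrite claw_setI.
  apply/eqP; rewrite claw_set_eq0 /=; apply/andP; split; apply/eqP/setP=> x; rewrite !inE.
    case: (x =P j) => [-> //|_] /=.
    by case xP : (x \in P); rewrite ?andbF // (dis _ xP).
  case: (x =P j) => [->|_] /=; first by rewrite eq_sym (negPf ej).
  case xP : (x \in P) => //; rewrite (dis _ xP) orbF.
  by apply: contraNF eP => /eqP<-.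
move=> /IHm; apply; last by rewrite inners_claw_set setU11.
rewrite leaves_claw_set setU1K; last by rewrite in_setD1 (negPf jP) andbF.
by move: ltm; rewrite (cardsD1 p P) pP add1n ltnS.
Qed.

(** By [compressed_meet], root-free traces meet each other and the traces of root members, which
    yields the hypotheses of [leaf_star_size_bound]. In the equality case, a singleton trace in [PP]
    forces its leaf into every member. *)
Lemma compressed_family_bound (N r : nat) (F : {set {set claw_vertex N.+1}}) :
    0 < r <= N -> F \subset indep_sets (@claw_adj N.+1) r -> intersecting F ->
    compressed F ->
  #|F| <= leaf_star_size N r /\
  (3 < r < N -> #|F| = leaf_star_size N r ->
     exists j, F = star (@claw_adj N.+1) r (Some (inr j))).
Proof.
move=> /andP[r0 rN] sF iF cF.
have rN1 : 0 < r <= N.+1 by rewrite r0 ltnW.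
have indep := subsetP sF.
pose PP := [set leaves A | A in F & None \notin A].
pose QQ := [set leaves A | A in F & None \in A].
have PPX A : A \in F -> {in PP, forall P, leaves A :&: P != set0}.
  move=> AF P /imsetP[B]; rewrite inE => /andP[BF cB] ->.
  by have := compressed_meet sF iF cF AF BF; rewrite (negPf cB) andbF.
have PPPP : crossing PP PP.
  by move=> P P' /imsetP[A]; rewrite inE => /andP[AF _] -> /(PPX A AF).
have PPQQ : crossing PP QQ.
  move=> P Q PPP /imsetP[A]; rewrite inE => /andP[AF _] ->.
  by rewrite setIC PPX.
have Qr : uniform r.-1 QQ.
  move=> Q /imsetP[A]; rewrite inE => /andP[AF cA] ->.
  have /claw_indepP[_ /(_ cA) D0 <-] := indep _ AF.
  by rewrite cA D0 cards0 addn0.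
pose p k := #|[set P in PP | #|P| == k]|.
have Pk k : uniform k [set P in PP | #|P| == k].
  by move=> P; rewrite inE => /andP[_ /eqP].
have sub k : {subset [set P in PP | #|P| == k] <= PP}.
  by move=> P; rewrite inE => /andP[].
have Fle : #|F| <= \sum_(k < N.+2) 'C(N.+1 - k, N.+1 - r) * p k + #|QQ|.
  rewrite -(sum_by_card (fun k => 'C(N.+1 - k, N.+1 - r))) -card_claw_span //.
  apply: subset_leq_card; apply/subsetP=> A AF; rewrite in_set indep //=.
  by case: ifPn => cA; apply: imset_f; rewrite inE AF.
have pE k : k.*2 <= N.+1 -> p k <= through_count N k.
  case: k => [|k] kN.
    rewrite leqn0 cards_eq0 -subset0; apply/subsetP=> P.
    rewrite inE cards_eq0 => /andP[PPP /eqP P0].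
    by have := PPPP _ _ PPP PPP; rewrite P0 setI0 eqxx.
  by apply: (@erdos_ko_rado N k.+1) => // A B /sub AP /sub; apply: PPPP.
have pC k : k <= N.+1 -> p k + p (N.+1 - k) <= 'C(N.+1, k).
  by move=> kN; apply: crossing_compl_bound => // A B /sub AP /sub; apply: PPPP.
have pX : r.*2 <= N.+2 -> p r + #|QQ| <= 'C(N.+1, r.-1).
  move=> r2; apply: cross_intersecting_bound => //.
    by move=> A B /sub AP /sub; apply: PPPP.
  by move=> A B /sub; apply: PPQQ.
have pD : p (N.+1 - r.-1) + #|QQ| <= 'C(N.+1, r.-1).
  rewrite addnC; apply: crossing_compl_bound => //; first by lia.
  by move=> A B AQ /sub BP; rewrite setIC PPQQ.
split; first by apply: leq_trans Fle _; apply: leaf_star_size_bound => //; rewrite r0.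
move=> /andP[r3 rltN] eqF.
have [p1 | p1] := posnP (p 1); last first.
  have /card_gt0P[P] := p1; rewrite inE => /andP[PPP /cards1P[j Pj]].
  exists j; apply/eqP; rewrite eqEcard card_star_leaf // eqF leqnn andbT.
  apply/subsetP=> A AF; rewrite in_set indep //=.
  have /set0Pn[x] := PPX _ AF _ PPP.
  by rewrite Pj in_setI in_set1 => /andP[/[swap] /eqP->]; rewrite in_set.
(* The singleton trace may be added at the cost of the (weightless) traces of
   size N, keeping all the bounds and gaining the weight of a singleton. *)
pose p' k := if k == 1 then 1 else if k == N then 0 else p k.
have lt : \sum_(k < N.+2) 'C(N.+1 - k, N.+1 - r) * p k
    < \sum_(k < N.+2) 'C(N.+1 - k, N.+1 - r) * p' k.
  rewrite (bigD1 (inord 1)) //= [ltnRHS](bigD1 (inord 1)) //= -addSn.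
  rewrite /p' inordK // p1 muln0 eqxx muln1; apply: leq_add.
    by rewrite bin_gt0; lia.
  apply: leq_sum => k _; case: eqP => [->|_]; first by rewrite p1 muln0.
  case: eqP => [->|//]; rewrite bin_small //; lia.
have le : \sum_(k < N.+2) 'C(N.+1 - k, N.+1 - r) * p' k + #|QQ| <= leaf_star_size N r.
  apply: leaf_star_size_bound; first by rewrite r0.
  - move=> k kN; rewrite /p'; case: eqP => [->|_]; first by rewrite /= bin0.
    by case: ifP => // _; apply: pE.
  - move=> k kN; rewrite /p'; have := pC _ kN.
    case: eqP => [->|k1].
      rewrite subn1 /= eqxx (_ : (N == 1) = false) ?bin1; lia.
    case: eqP => [->|kN'] leC.
      have -> : N.+1 - N = 1 by rewrite subSnn.
      by rewrite eqxx bin_gt0 leqnSn.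
    have n1 : (N.+1 - k == 1) = false by apply/eqP; lia.
    have nN : (N.+1 - k == N) = false by apply/eqP; lia.
    by rewrite n1 nN.
  (* Since 3 < r < N, neither r nor N + 2 - r is 1 or N, so [p'] agrees with [p] at both. *)
  - by move=> r2; rewrite /p' !ifF ?pX //; lia.
  - by rewrite /p' !ifF ?pD //; lia.
by move: Fle; rewrite eqF; lia.
Qed.

(** Induction on [inner_weight]: a family that is not compressed is shifted, keeping its size, and
    [shift_family_star] carries the equality case back. *)
Lemma intersecting_family_bound (N r : nat) (F : {set {set claw_vertex N.+1}}) :
    0 < r <= N -> F \subset indep_sets (@claw_adj N.+1) r -> intersecting F ->
  #|F| <= leaf_star_size N r /\
  (3 < r < N -> #|F| = leaf_star_size N r ->
     exists j, F = star (@claw_adj N.+1) r (Some (inr j))).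
Proof.
move=> rN; have [m] := ubnP (inner_weight F); elim: m F => // m IHm F ltm sF iF.
have [|] := boolP (compressed F); first exact: compressed_family_bound.
case/forallPn=> i /forall_inPn[A AF AS].
have lt := inner_weight_shift sF AF AS.
have := IHm (shift_family i F) (leq_trans lt ltm) (shift_family_indep i sF)
  (shift_family_intersecting i sF iF).
rewrite (card_shift_family i sF) => -[-> st]; split=> // r3 /(st r3)[j eqS].
by exists j; apply: shift_family_star eqS => //; lia.
Qed.

Lemma star_sub_indep (T : finType) (e : rel T) r v :
  star e r v \subset indep_sets e r.
Proof. by apply/subsetP=> A; rewrite in_set => /andP[]. Qed.

Lemma star_intersecting (T : finType) (e : rel T) r v : intersecting (star e r v).
Proof.
apply/intersectingP=> A B; rewrite !in_set => /andP[_ vA] /andP[_ vB].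
by apply/set0Pn; exists v; rewrite in_setI vA.
Qed.

Theorem theorem9p3 (n r : nat) :
  1 <= r <= n - 1 ->
  EKR (@claw_adj n) r /\ (4 <= r < n - 1 -> strictly_EKR (@claw_adj n) r).
Proof.
case: n => [|N]; first by lia.
rewrite subn1 /= => rN.
have leStar v : #|star (@claw_adj N.+1) r v| <= max_intersecting (@claw_adj N.+1) r.
  apply: (leq_bigmax_cond (F := fun F : {set {set _}} => #|F|)).
  by rewrite star_sub_indep star_intersecting.
have cardS : #|star (@claw_adj N.+1) r (Some (inr ord0))| = leaf_star_size N r.
  by apply: card_star_leaf; lia.
have maxE : max_intersecting (@claw_adj N.+1) r = leaf_star_size N r.
  apply/eqP; rewrite eqn_leq -{2}cardS leStar andbT.
  apply/bigmax_leqP=> F /andP[sF iF].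
  by have [] := intersecting_family_bound rN sF iF.
have ekr : EKR (@claw_adj N.+1) r.
  apply/eqP; rewrite /EKR eqn_leq; apply/andP; split.
    rewrite maxE -cardS.
    exact: (leq_bigmax (F := fun v => #|star (@claw_adj N.+1) r v|)).
  by apply/bigmax_leqP=> v _.
split=> // r4; split=> // F sF iF; rewrite maxE => cF.
have [_ /(_ r4 cF)[j ->]] := intersecting_family_bound rN sF iF.
by exists (Some (inr j)).
Qed.
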